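(* Let $\beta\in(1,\frac{1+\sqrt5}{2})$. Then there exists $c=c(\beta)>0$ such that every $x\in[-c,c]$ has a hybrid expansion.
   Context: Given $\beta\in(1,2)$ and $x\in[\frac{-1}{\beta-1},\frac{1}{\beta-1}]$, a sequence $(\epsilon_i)_{i\ge1}\in\{-1,1\}^{\mathbb{N}}$ is a hybrid expansion of $x$ (in base $\beta$) if both $x=\sum_{i=1}^{\infty}\frac{\epsilon_i}{\beta^i}$ and $x=\lim_{n\to\infty}\frac1n\sum_{i=1}^{n}\epsilon_i$ hold. *)

(* Defs.v *)
From Stdlib Require Import Reals.
From Coquelicot Require Import Coquelicot.
Open Scope R_scope.

(* Sequences are indexed from 0: [eps i] is the digit epsilon_{i+1}. *)
Definition digit_sequence (eps : nat -> R) : Prop :=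
  forall i : nat, eps i = -1 \/ eps i = 1.

(* [sum_n eps n] is eps 0 + ... + eps n, the sum of the first n+1 digits.
   The range condition |x| <= 1 / (beta - 1) is not repeated, since for
   beta > 1 it follows from the series equation. *)
Definition hybrid_expansion (beta x : R) (eps : nat -> R) : Prop :=
  digit_sequence eps /\
  is_series (fun i : nat => eps i / beta ^ (S i)) x /\
  is_lim_seq (fun n : nat => sum_n eps n / INR (S n)) (Finite x).

(* Main.v *)
Require Import Defs.
From Stdlib Require Import Reals Lra.
From Coquelicot Require Import Coquelicot.
Open Scope R_scope.

(** Choosing digits [eps i] amounts to steering the remainder
    [y (S i) = b * y i - eps i] with [y 0 = x]: the series of the digits sums
    to [x] as soon as the remainders stay bounded.  The quantity
    [u n = eps 0 + ... + eps (n - 1) + y n - n * x], called the drift, obeys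
    [u (S n) = u n + (b - 1) * y n - x], in which the digit no longer occurs.
    So [x] has a hybrid expansion if [y] and [u] can be kept bounded together:
    then the sum of the first [n] digits is [n * x + O(1)].

    Steering upwards.  Fix a threshold [a > 0] and take the digit [-1] exactly
    when [y < a].  The remainders stay within [b * a + 1] of 0 if this number is
    less than [1 / (b - 1)], and they cannot linger near the repelling
    point [- 1 / (b - 1)].  Once [y] has been at least [a], it never falls
    below [b * a - 1].  If [(b + 1) * a > 1], a remainder from [b * a - 1] up to
    [a] is sent to one that is at least [a], and the sum of the two exceeds some
    positive constant.  Hence the remainders are positive on average, and the
    drift tends to increase when [|x|] is small.  Both requirements read
    [1 / (b + 1) < a < (2 - b) / (b * (b - 1))], and such an [a] exists
    precisely when [b ^ 2 < b + 1], that is, below the golden ratio.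

    Feedback.  Steer upwards while the drift is negative, and by the mirror
    image of that rule otherwise.  Before it starts to rise, the drift may still
    fall by an amount that depends on [y]; the function [reserve] bounds this
    amount, and [up_digit_reserve] is the corresponding Lyapunov inequality.
    It makes the region [safe] invariant ([safe_step]), and this region is
    bounded. *)

(** * Bounded remainders and bounded drift give a hybrid expansion *)

Lemma is_lim_seq_bounded_div (v w : nat -> R) (M : R) :
  (forall n, Rabs (v n) <= M) -> (forall n, 0 < w n) ->
  is_lim_seq w p_infty -> is_lim_seq (fun n => v n / w n) 0.
Proof.
intros Hv Hw Hlim.
assert (Hinv : is_lim_seq (fun n => / w n) 0).
{ apply (is_lim_seq_inv w p_infty Hlim); discriminate. }
apply is_lim_seq_abs_0.
apply is_lim_seq_le_le with (u := fun _ => 0) (w := fun n => M * / w n).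
- intros n; split; [apply Rabs_pos|].
  assert (Hi : 0 < / w n) by (apply Rinv_0_lt_compat, Hw).
  unfold Rdiv; rewrite Rabs_mult, (Rabs_pos_eq (/ w n)) by lra.
  apply Rmult_le_compat_r; [lra | apply Hv].
- apply is_lim_seq_const.
- replace (Finite 0) with (Rbar_mult M 0) by (simpl; f_equal; ring).
  now apply is_lim_seq_scal_l.
Qed.

Lemma hybrid_expansion_of_bounded (b x Y D : R) (eps y u : nat -> R) :
  1 < b -> digit_sequence eps ->
  y O = x -> u O = x ->
  (forall n, y (S n) = b * y n - eps n) ->
  (forall n, u (S n) = u n + (b - 1) * y n - x) ->
  (forall n, Rabs (y n) <= Y) -> (forall n, Rabs (u n) <= D) ->
  hybrid_expansion b x eps.
Proof.
intros Hb Heps Hy0 Hu0 HyS HuS HY HD.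
assert (Hpow : forall n, 0 < b ^ n) by (intros n; apply pow_lt; lra).
assert (Hseries : forall n,
  sum_n (fun i => eps i / b ^ S i) n = x - y (S n) / b ^ S n).
{ induction n as [|n IH].
  - rewrite sum_O, HyS, Hy0; simpl; field; lra.
  - rewrite sum_Sn, IH, (HyS (S n)); unfold plus; simpl.
    specialize (Hpow n); field; lra. }
assert (Hsum : forall n, sum_n eps n = u (S n) - y (S n) + INR (S n) * x).
{ induction n as [|n IH].
  - rewrite sum_O, HyS, HuS, Hy0, Hu0; simpl; ring.
  - rewrite sum_Sn, IH, (HyS (S n)), (HuS (S n)), (S_INR (S n)).
    unfold plus; simpl; ring. }
split; [exact Heps | split].
- change (is_lim_seq (sum_n (fun i => eps i / b ^ S i)) x).
  apply (is_lim_seq_ext (fun n => x - y (S n) / b ^ S n)).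
  { intros n; now rewrite Hseries. }
  replace (Finite x) with (Finite (x - 0)) by (f_equal; ring).
  apply is_lim_seq_minus'; [apply is_lim_seq_const|].
  apply (is_lim_seq_bounded_div (fun n => y (S n)) (fun n => b ^ S n) Y); auto.
  apply (is_lim_seq_incr_1 (fun n => b ^ n)).
  now apply is_lim_seq_geom_p.
- apply (is_lim_seq_ext (fun n => (u (S n) - y (S n)) / INR (S n) + x)).
  { intros n; rewrite Hsum; field; apply not_0_INR; discriminate. }
  replace (Finite x) with (Finite (0 + x)) by (f_equal; ring).
  apply is_lim_seq_plus'; [|apply is_lim_seq_const].
  apply (is_lim_seq_bounded_div (fun n => u (S n) - y (S n))
           (fun n => INR (S n)) (D + Y)).
  + intros n; apply Rle_trans with (1 := Rabs_triang _ _).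
    rewrite Rabs_Ropp; apply Rplus_le_compat; auto.
  + intros n; apply lt_0_INR; apply Nat.lt_0_succ.
  + apply (is_lim_seq_incr_1 INR), is_lim_seq_INR.
Qed.

(** * Steering upwards *)

Definition radius (b a : R) : R := b * a + 1.

Definition admissible (b a : R) : Prop :=
  1 < b /\ 1 < (b + 1) * a /\ (b - 1) * radius b a < 1.

(** The golden ratio enters here only: the two bounds on the threshold leave
    room between them because [b ^ 2 < b + 1]. *)
Lemma exists_admissible (b : R) :
  1 < b < (1 + sqrt 5) / 2 -> exists a, admissible b a.
Proof.
intros [Hb Hgold].
assert (Hs0 := sqrt_pos 5).
assert (Hs : sqrt 5 * sqrt 5 = 5) by (apply sqrt_sqrt; lra).
assert (Hbb : b * b < b + 1) by nra.
set (lo := / (b + 1)); set (hi := (2 - b) / (b * (b - 1))).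
assert (Hlo : (b + 1) * lo = 1) by (unfold lo; field; lra).
assert (Hhi : (b - 1) * (b * hi + 1) = 1) by (unfold hi; field; lra).
assert (Hlt : lo < hi).
{ apply Rmult_lt_reg_l with ((b + 1) * (b * (b - 1))); [nra|].
  replace ((b + 1) * (b * (b - 1)) * lo) with (b * (b - 1))
    by (unfold lo; field; lra).
  replace ((b + 1) * (b * (b - 1)) * hi) with ((b + 1) * (2 - b))
    by (unfold hi; field; lra).
  nra. }
exists ((lo + hi) / 2).
assert (0 < b * (b - 1)) by nra.
unfold admissible, radius; repeat split; nra.
Qed.

Definition up_digit (a y : R) : R := if Rlt_dec y a then -1 else 1.

Lemma up_digit_radius (b a y : R) :
  admissible b a -> Rabs y <= radius b a ->
  Rabs (b * y - up_digit a y) <= radius b a.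
Proof.
unfold admissible, radius, up_digit; intros (Hb & Ha & Hr) Hy.
apply Rabs_le_between in Hy; apply Rabs_le_between.
assert (0 < a) by nra.
destruct (Rlt_dec y a); split; nra.
Qed.

(** The preimage of the threshold under the digit [-1]: from a remainder
    between [knee] and the threshold, one step leads above the threshold. *)
Definition knee (b a : R) : R := (a - 1) / b.

(** Half of the gain of the drift over two steps from [knee] to [a], for
    [x = 0]; it is the margin available for [x]. *)
Definition slack (b a : R) : R := (b - 1) * (a + knee b a) / 2.

(** The value of [reserve] between [knee] and the threshold.  It has to absorb
    a loss of at most [slack - (b - 1) * knee], and a step above the threshold,
    which gains at least [(b - 1) * a - slack], has to pay for it; with the
    above choice of [slack] these two bounds coincide. *)
Definition toll (b a : R) : R := (b - 1) * (a - knee b a) / 2.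

Definition drift_bound (b a : R) : R := (b - 1) * radius b a + slack b a.

(** Below [knee] every step raises the remainder by at least
    [1 - (b - 1) * radius], so that each unit of height still to be climbed
    costs the drift at most [slope]. *)
Definition slope (b a : R) : R := drift_bound b a / (1 - (b - 1) * radius b a).

Definition reserve (b a y : R) : R :=
  if Rlt_dec y (knee b a)
  then toll b a + drift_bound b a + slope b a * (knee b a - y)
  else if Rlt_dec y a then toll b a else 0.

Lemma knee_mult (b a : R) : admissible b a -> b * knee b a = a - 1.
Proof. intros [Hb _]; unfold knee; field; lra. Qed.

(** [a + knee > 0] is where [(b + 1) * a > 1] is needed. *)
Lemma knee_bounds (b a : R) :
  admissible b a -> 0 < a /\ - a < knee b a < a.
Proof.
intros H; assert (Hk := knee_mult b a H); destruct H as (Hb & Ha & Hr).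
assert (0 < a) by nra.
repeat split; nra.
Qed.

Lemma slack_pos (b a : R) : admissible b a -> 0 < slack b a.
Proof.
intros H; destruct (knee_bounds b a H) as (Ha0 & Hk1 & Hk2).
destruct H as (Hb & _); unfold slack; nra.
Qed.

Lemma slack_le_drift_bound (b a : R) :
  admissible b a -> slack b a <= drift_bound b a.
Proof.
intros H; destruct (knee_bounds b a H) as (Ha0 & _).
destruct H as (Hb & _); unfold drift_bound, radius.
assert (0 < b * a) by nra; nra.
Qed.

Lemma slack_le_radius (b a : R) : admissible b a -> slack b a <= radius b a.
Proof.
intros H; destruct (knee_bounds b a H) as (Ha0 & Hk1 & Hk2).
destruct H as (Hb & Ha & Hr); unfold slack.
assert (Hba : a < b * a) by nra.
unfold radius in *.
assert (b - 1 < 1) by nra.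
nra.
Qed.

Lemma slope_pos (b a : R) : admissible b a -> 0 < slope b a.
Proof.
intros H; assert (Hs := slack_pos b a H).
assert (Hd := slack_le_drift_bound b a H); destruct H as (_ & _ & Hr).
unfold slope; apply Rdiv_lt_0_compat; lra.
Qed.

Definition reserve_bound (b a : R) : R :=
  toll b a + drift_bound b a + slope b a * (knee b a + radius b a).

Lemma reserve_le (b a y : R) :
  admissible b a -> Rabs y <= radius b a -> reserve b a y <= reserve_bound b a.
Proof.
intros H Hy; apply Rabs_le_between in Hy.
assert (Hs := slope_pos b a H); assert (Hsl := slack_pos b a H).
assert (Hd := slack_le_drift_bound b a H).
destruct (knee_bounds b a H) as (Ha0 & Hk1 & Hk2).
destruct H as (Hb & Ha & Hr).
assert (Ht : 0 < toll b a) by (unfold toll; nra).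
assert (Hkr : 0 < knee b a + radius b a) by (unfold radius; nra).
assert (0 < slope b a * (knee b a + radius b a)) by nra.
unfold reserve, reserve_bound.
destruct (Rlt_dec y (knee b a)); [nra|].
destruct (Rlt_dec y a); lra.
Qed.

(** Each of the three pieces of [reserve] pays for the worst step that starts
    in it: [toll] for the step that ends above the threshold, [drift_bound] for
    the step that first reaches [knee], and [slope] for the climb before it. *)
Lemma up_digit_reserve (b a x y : R) :
  admissible b a -> Rabs x <= slack b a -> Rabs y <= radius b a ->
  reserve b a (b * y - up_digit a y) <= reserve b a y + (b - 1) * y - x.
Proof.
intros H Hx Hy; apply Rabs_le_between in Hx; apply Rabs_le_between in Hy.
assert (Hs := slope_pos b a H); assert (Hk := knee_mult b a H).
destruct (knee_bounds b a H) as (Ha0 & Hk1 & Hk2).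
destruct H as (Hb & Ha & Hr).
assert (Hsl : slope b a * (1 - (b - 1) * radius b a) = drift_bound b a)
  by (unfold slope; field; lra).
assert (Hdrift : x - (b - 1) * y <= drift_bound b a)
  by (unfold drift_bound; nra).
assert (Ht : toll b a = (b - 1) * a - slack b a) by (unfold toll, slack; lra).
assert (Ht' : toll b a = slack b a - (b - 1) * knee b a)
  by (unfold toll, slack; lra).
assert (Ht0 : 0 < toll b a) by (unfold toll; nra).
unfold up_digit; destruct (Rlt_dec y a) as [Hya|Hya].
- destruct (Rlt_dec y (knee b a)) as [Hyk|Hyk].
  + assert (Hclimb : 0 <= slope b a * (knee b a - y)) by nra.
    assert (Hnext : b * y - -1 < a) by nra.
    unfold reserve; destruct (Rlt_dec y (knee b a)); [|lra].
    destruct (Rlt_dec (b * y - -1) (knee b a)).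
    * assert (Hgain : drift_bound b a <= slope b a * (b * y - -1 - y))
        by (rewrite <- Hsl; apply Rmult_le_compat_l; nra).
      nra.
    * destruct (Rlt_dec (b * y - -1) a); lra.
  + assert (Hnext : a <= b * y - -1) by nra.
    unfold reserve; destruct (Rlt_dec (b * y - -1) (knee b a)); [lra|].
    destruct (Rlt_dec (b * y - -1) a); [lra|].
    destruct (Rlt_dec y (knee b a)); [lra|].
    destruct (Rlt_dec y a); [nra|lra].
- assert (Hnext : knee b a <= b * y - 1).
  { (* [knee <= b * a - 1] amounts to [(b + 1) * a >= 1]. *)
    assert (Hbk : b * knee b a <= b * (b * a - 1)) by nra.
    nra. }
  assert (Hgain : toll b a <= (b - 1) * y - x) by nra.
  unfold reserve; destruct (Rlt_dec (b * y - 1) (knee b a)); [lra|].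
  destruct (Rlt_dec y (knee b a)); [lra|].
  destruct (Rlt_dec y a); [lra|].
  destruct (Rlt_dec (b * y - 1) a); lra.
Qed.

(** * Feedback *)

Definition feedback (a : R) (st : R * R) : R :=
  let (y, u) := st in
  if Rlt_dec u 0 then up_digit a y else - up_digit a (- y).

Lemma feedback_digit (a : R) (st : R * R) :
  feedback a st = -1 \/ feedback a st = 1.
Proof.
destruct st as [y u]; unfold feedback, up_digit.
destruct (Rlt_dec u 0); [destruct (Rlt_dec y a) | destruct (Rlt_dec (- y) a)];
  lra.
Qed.

Definition step (b a x : R) (st : R * R) : R * R :=
  (b * fst st - feedback a st, snd st + (b - 1) * fst st - x).

Definition cap (b a : R) : R := reserve_bound b a + drift_bound b a.

(** The drift may lie outside its target 0 by [cap], minus what the steering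
    towards 0 from [y] may still lose; the upper bound is the mirror image of
    the lower one. *)
Definition safe (b a : R) (st : R * R) : Prop :=
  let (y, u) := st in
  Rabs y <= radius b a /\
  reserve b a y - cap b a <= u <= cap b a - reserve b a (- y).

Lemma safe_mirror (b a y u : R) : safe b a (y, u) -> safe b a (- y, - u).
Proof.
unfold safe; rewrite Rabs_Ropp, Ropp_involutive; intros [Hy Hu].
split; [exact Hy | lra].
Qed.

(** On the side that the steering moves away from, [cap] leaves room for one
    step from 0; on the other side [up_digit_reserve] applies. *)
Lemma safe_up_step (b a x y u : R) :
  admissible b a -> Rabs x <= slack b a -> u <= 0 -> safe b a (y, u) ->
  safe b a (b * y - up_digit a y, u + (b - 1) * y - x).
Proof.
intros H Hx Hu (Hy & Hlow & _).
assert (Hy' := up_digit_radius b a y H Hy).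
assert (Hres := up_digit_reserve b a x y H Hx Hy).
assert (Hy'' : Rabs (- (b * y - up_digit a y)) <= radius b a)
  by now rewrite Rabs_Ropp.
assert (Hbnd := reserve_le b a _ H Hy'').
split; [exact Hy'|]; split; [lra|].
apply Rabs_le_between in Hx; apply Rabs_le_between in Hy.
destruct H as (Hb & _).
unfold cap, drift_bound; nra.
Qed.

Lemma safe_step (b a x : R) (st : R * R) :
  admissible b a -> Rabs x <= slack b a -> safe b a st ->
  safe b a (step b a x st).
Proof.
intros H Hx Hst; destruct st as [y u]; unfold step, feedback; simpl.
destruct (Rlt_dec u 0) as [Hu|Hu].
- apply safe_up_step; auto; lra.
- apply safe_mirror in Hst.
  rewrite <- Rabs_Ropp in Hx.
  assert (Hu' : - u <= 0) by lra.
  assert (Hup := safe_mirror _ _ _ _ (safe_up_step b a _ _ _ H Hx Hu' Hst)).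
  replace (b * y - - up_digit a (- y)) with (- (b * - y - up_digit a (- y)))
    by ring.
  replace (u + (b - 1) * y - x) with (- (- u + (b - 1) * - y - - x)) by ring.
  exact Hup.
Qed.

Lemma safe_initial (b a x : R) :
  admissible b a -> Rabs x <= slack b a -> safe b a (x, x).
Proof.
intros H Hx; assert (Hr : Rabs x <= radius b a)
  by exact (Rle_trans _ _ _ Hx (slack_le_radius b a H)).
assert (Hr' : Rabs (- x) <= radius b a) by now rewrite Rabs_Ropp.
assert (Hres := reserve_le b a x H Hr).
assert (Hres' := reserve_le b a (- x) H Hr').
assert (Hd := slack_le_drift_bound b a H).
apply Rabs_le_between in Hx.
unfold safe, cap; split; [exact Hr | lra].
Qed.

Lemma reserve_nonneg (b a y : R) : admissible b a -> 0 <= reserve b a y.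
Proof.
intros H; assert (Hs := slope_pos b a H); assert (Hsl := slack_pos b a H).
assert (Hd := slack_le_drift_bound b a H).
destruct (knee_bounds b a H) as (Ha0 & Hk1 & Hk2); destruct H as (Hb & _).
assert (Ht : 0 < toll b a) by (unfold toll; nra).
unfold reserve; destruct (Rlt_dec y (knee b a)); [nra|].
destruct (Rlt_dec y a); lra.
Qed.

Lemma safe_bounded (b a y u : R) :
  admissible b a -> safe b a (y, u) ->
  Rabs y <= radius b a /\ Rabs u <= cap b a.
Proof.
intros H [Hy Hu]; split; [exact Hy|].
assert (H1 := reserve_nonneg b a y H).
assert (H2 := reserve_nonneg b a (- y) H).
apply Rabs_le_between; lra.
Qed.

Theorem theorem2p4 :
  forall beta : R, 1 < beta < (1 + sqrt 5) / 2 ->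
  exists c : R, 0 < c /\
    forall x : R, -c <= x <= c ->
      exists eps : nat -> R, hybrid_expansion beta x eps.
Proof.
intros b Hb; destruct (exists_admissible b Hb) as [a Ha].
exists (slack b a); split; [now apply slack_pos|].
intros x Hx; apply Rabs_le_between in Hx.
set (orbit := fun n => Nat.iter n (step b a x) (x, x)).
assert (Hsafe : forall n, safe b a (orbit n)).
{ induction n as [|n IH]; [now apply safe_initial | now apply safe_step]. }
assert (Hbound : forall n, Rabs (fst (orbit n)) <= radius b a /\
                           Rabs (snd (orbit n)) <= cap b a).
{ intros n; apply (safe_bounded b a); auto.
  rewrite <- surjective_pairing; apply Hsafe. }
exists (fun n => feedback a (orbit n)).
apply (hybrid_expansion_of_bounded b x (radius b a) (cap b a) _
         (fun n => fst (orbit n)) (fun n => snd (orbit n)));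
  try reflexivity; try apply Hbound; [tauto|].
intros n; apply feedback_digit.
Qed.
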